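(* Let $(X,d)$ be a separable metric space and let $\mathcal{F}\subseteq \mathcal{C}_b(X)$ be a set of bounded continuous complex-valued functions on $X$. Assume that (T.1) $\mathcal{F}$ is multiplicatively closed and closed under complex conjugation; (T.2) $\mathcal{F}$ induces the topology of $X$; (T.3) for every $d$-bounded set $A\subseteq X$ there exist $f\in\mathcal{F}$ and $\delta>0$ with $\inf_{x\in A}|f(x)|>\delta$. Then $\mathcal{F}$ is weak$^\#$-convergence determining for measures in $\mathcal{M}^\#_{\mathcal{F}}(X)$, i.e. whenever $\mu,\mu_n\in\mathcal{M}^\#_{\mathcal{F}}(X)$ ($n\in\mathbb{N}$) satisfy $\int f\,d\mu_n\to\int f\,d\mu$ as $n\to\infty$ for all $f\in\mathcal{F}$, then $\mu_n\xrightarrow{w^\#}\mu$.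
   Context: $X$ carries the Borel $\sigma$-field induced by $d$; $\mathcal{M}(X)$ is the set of (non-negative, possibly infinite) measures on it. $\mathcal{C}_b(X)$ is the set of bounded continuous functions $X\to\mathbb{C}$, and $\mathcal{C}_b(X;\mathbb{R})$ the subset of real-valued ones. The set of boundedly finite measures is $\mathcal{M}^\#(X)=\{\mu\in\mathcal{M}(X) : \mu(A)<\infty \text{ for all } d\text{-bounded measurable } A\subseteq X\}$. A sequence $(\mu_n)$ in $\mathcal{M}^\#(X)$ is weak$^\#$-convergent to $\mu\in\mathcal{M}^\#(X)$, written $\mu_n\xrightarrow{w^\#}\mu$, if $\int f\,d\mu_n\to\int f\,d\mu$ for all $f\in\mathcal{C}_b(X;\mathbb{R})$ with $d$-bounded support. For a set $\mathcal{F}$ of measurable $\mathbb{C}$-valued functions, $\mathcal{M}_{\mathcal{F}}(X)=\{\mu\in\mathcal{M}(X): \int|f|\,d\mu<\infty\ \forall f\in\mathcal{F}\}$ and $\mathcal{M}^\#_{\mathcal{F}}(X)=\mathcal{M}^\#(X)\cap\mathcal{M}_{\mathcal{F}}(X)$. ''$\mathcal{F}$ induces the topology of $X$'' means that the topology of $X$ is the initial topology of $\mathcal{F}$, i.e. the coarsest topology making all $f\in\mathcal{F}$ continuous. ''Multiplicatively closed'' means $f,g\in\mathcal{F}$ implies $fg\in\mathcal{F}$. *)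

(* Defs.v *)
From HB Require Import structures.
From mathcomp Require Import all_boot all_order all_algebra complex.
From mathcomp Require Import all_classical all_reals all_analysis.

Set Implicit Arguments.
Unset Strict Implicit.
Unset Printing Implicit Defensive.

Import Order.TTheory GRing.Theory Num.Theory.
Import numFieldNormedType.Exports.

Local Open Scope classical_set_scope.
Local Open Scope ring_scope.

(* The modulus metric on [R[i]], which is not canonical in the library because
   it is only attached to [R[i]^o] and to abstract [numFieldType]s. *)
HB.instance Definition _ (R : rcfType) := NormedModule.copy R[i] R[i]^o.

(* A [measurableType] is always pointed, so a metric space that carries a
   Borel sigma-algebra has to be pointed as well.  The chosen point is only a
   witness of non-emptiness. *)
#[short(type="pmetricType")]
HB.structure Definition PointedMetric (K : numDomainType) :=
  {T of PseudoPointedMetric K T & Metric K T}.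

Section weak_sharp.
Context {R : realType} (X : pmetricType R).

Definition separable := exists2 D : set X, countable D & dense D.

Definition mdist_bounded (A : set X) :=
  exists M : R, forall x y, A x -> A y -> mdist x y <= M.

Notation borelType := (g_sigma_algebraType (@open X)).

Notation measures := {measure set borelType -> \bar R}.

(* The library has no integral of complex-valued functions. *)
Definition cintegral (mu : measures) (f : X -> R[i]) : R[i] :=
  ((\int[mu]_x complex.Re (f x)) +i* (\int[mu]_x complex.Im (f x)))%C.

Definition bounded_continuous : set (X -> R[i]) :=
  [set f | continuous f /\ bounded_fun f].

Definition bounded_continuous_real : set (X -> R) :=
  [set f | continuous f /\ bounded_fun f].

Definition mult_closed (F : set (X -> R[i])) :=
  forall f g, F f -> F g -> F (f \* g).

Definition conj_closed (F : set (X -> R[i])) :=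
  forall f, F f -> F (fun x => (f x)^*%C).

Definition induces_topology (F : set (X -> R[i])) :=
  @open X = @open (sup_topology (fun f : {f | F f} =>
                     Topological.class (initial_topology (sval f)))).

Definition boundedly_finite : set measures :=
  [set mu : measures | forall A : set borelType,
     measurable A -> mdist_bounded A -> (mu A < +oo)%E].

Definition abs_integrable (F : set (X -> R[i])) : set measures :=
  [set mu : measures | forall f, F f -> (\int[mu]_x (Normc.normc (f x))%:E < +oo)%E].

Definition boundedly_finite_integrable (F : set (X -> R[i])) : set measures :=
  boundedly_finite `&` abs_integrable F.

Definition weak_sharp_cvg (mu_ : nat -> measures) (mu : measures) :=
  forall f, bounded_continuous_real f ->
    mdist_bounded (closure [set x | f x != 0]) ->
    (\int[mu_ n]_x (f x)%:E)%E @[n --> \oo] --> (\int[mu]_x (f x)%:E)%E.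

Definition weak_sharp_cvg_determining (F : set (X -> R[i]))
    (M : set measures) :=
  forall (mu_ : nat -> measures) (mu : measures),
    (forall n, M (mu_ n)) -> M mu ->
    (forall f, F f -> cintegral (mu_ n) f @[n --> \oo] --> cintegral mu f) ->
    weak_sharp_cvg mu_ mu.

End weak_sharp.

(* Main.v *)
(* Write [h = |f0|^2] with [f0] in [F] bounded below on the support of the test
   function [g], so that [g = G * h] with [G] bounded and continuous; it suffices
   that the finite measures [h mu_n] converge weakly to [h mu].  Since [F] is
   closed under products and conjugation, the real span of [1], [Re f], [Im f]
   ([f] in [F]) is an algebra on which the integrals against [h mu_n] converge,
   and this passes to its uniform closure [W].  As in the Stone-Weierstrass
   theorem, [W] is a lattice.  Because [F] induces the topology, [W] contains, for
   every neighbourhood of a point, a function peaking at that point and vanishing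
   off the neighbourhood; with separability, every bounded continuous [G >= 0] is
   therefore the pointwise limit of a sequence in [W] lying between [0] and [G].
   This gives [liminf int G h dmu_n >= int G h dmu], and applying it to [M + G]
   and [M - G] gives convergence. *)
Require Import Defs.
From HB Require Import structures.
From mathcomp Require Import all_boot all_order all_algebra complex.
From mathcomp Require Import all_classical all_reals all_analysis.
From mathcomp Require Import measurable_realfun ring lra.
Import Order.TTheory GRing.Theory Num.Theory.
Import numFieldNormedType.Exports.
Local Open Scope classical_set_scope.
Local Open Scope ring_scope.

Set Implicit Arguments.
Unset Strict Implicit.

(** * The uniform closure of an algebra of bounded functions is a lattice *)

Section uniform_closure.
Context {R : realType} {T : Type}.
Implicit Types (V : set (T -> R)) (u v : T -> R).

Definition subalgebra V :=
  [/\ V (cst 1),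
      forall a u, V u -> V (fun x => a * u x),
      forall u v, V u -> V v -> V (u \+ v) &
      forall u v, V u -> V v -> V (u \* v)].

Definition uniform_closure V : set (T -> R) :=
  [set u | forall e : R, 0 < e -> exists2 v, V v & forall x, `|u x - v x| <= e].

(* Polynomials in [t] increasing to [|t|] on [[-1, 1]]. *)
Fixpoint abs_approx (t : R) (n : nat) : R :=
  if n is m.+1 then
    abs_approx t m + (t ^+ 2 - abs_approx t m ^+ 2) / 2
  else 0.

(** Writing [p] for the current approximation, each step multiplies the error [|t| - p] by
    [1 - (|t| + p) / 2], which lies in [0, 1] as long as [0 <= p <= |t| <= 1]. *)
Lemma abs_approx_itv t n : `|t| <= 1 -> 0 <= abs_approx t n <= `|t|.
Proof.
move=> t1; elim: n => [|n /andP[p0 pt]] /=; first by rewrite lexx normr_ge0.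
rewrite -[t ^+ 2]real_normK ?num_real//.
by apply/andP; split; nra.
Qed.

(** Since [|t| + p] is at least the error [e], one step sends [e] to at most [e * (1 - e / 2)], and
    this recursion forces decay at rate [2 / (n + 1)]. The rate does not depend on [t], so
    convergence is uniform. *)
Lemma abs_approx_error t n : `|t| <= 1 ->
  (`|t| - abs_approx t n) * n.+1%:R <= 2.
Proof.
move=> t1; elim: n => [|n] /=; first by rewrite subr0 mulr1; lra.
have /andP[] := abs_approx_itv n t1.
rewrite -[t ^+ 2]real_normK ?num_real//.
set p := abs_approx t n; move: (normr_ge0 t) t1; set s := `|t|.
move=> s0 s1 p0 ps IH.
rewrite [n.+2%:R]mulrSr; move: IH; have : 1 <= n.+1%:R :> R by rewrite ler1n.
set m : R := n.+1%:R => m1 IH.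
have -> : s - (p + (s ^+ 2 - p ^+ 2) / 2) = (s - p) * (1 - (s + p) / 2) by field.
set e := s - p in IH *.
have e0 : 0 <= e by rewrite subr_ge0.
have es : e <= s by rewrite /e; lra.
have : e * (1 - (s + p) / 2) <= e * (1 - e / 2) by apply: ler_wpM2l => //; lra.
move=> H; apply: (le_trans (ler_wpM2r _ H)); first by lra.
(* If [e * (m + 1) <= 2], the factor [1 - e / 2] only helps; otherwise [(1 - e / 2) * (m + 1) < m]
   and the induction hypothesis [e * m <= 2] concludes. *)
by rewrite /= in IH; have [em|em] := leP (e * (m + 1)) 2; nra.
Qed.

Variable V : set (T -> R).
Hypothesis algV : subalgebra V.
Hypothesis bndV : forall v, V v -> exists M : R, forall x, `|v x| <= M.
Local Notation W := (uniform_closure V).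

Lemma sub_uniform_closure : V `<=` W.
Proof. by move=> u Vu e e0; exists u => // x; rewrite subrr normr0 ltW. Qed.

Lemma uniform_closureD u v : W u -> W v -> W (u \+ v).
Proof.
case: algV => _ _ VD _ Wu Wv e e0.
have e20 : 0 < e / 2 by lra.
have [u' Vu' uu'] := Wu _ e20; have [v' Vv' vv'] := Wv _ e20.
exists (u' \+ v') => [|x]; first exact: VD.
rewrite /= opprD addrACA (le_trans (ler_normD _ _))//.
by rewrite [leRHS]splitr lerD.
Qed.

Lemma uniform_closureZ a u : W u -> W (fun x => a * u x).
Proof.
case: algV => _ VZ _ _ Wu e e0.
have a0 : 0 < `|a| + 1 by rewrite ltr_pwDr.
have [v Vv uv] := Wu _ (divr_gt0 e0 a0).
exists (fun x => a * v x) => [|x]; first exact: VZ.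
rewrite -mulrBr normrM (le_trans (ler_wpM2l _ (uv x)))//.
by rewrite mulrCA ler_piMr ?ltW// ltr_pdivrMr// mul1r ltrDl.
Qed.

Lemma uniform_closure_cst a : W (cst a).
Proof.
have -> : cst a = (fun x => a * cst 1 x) :> (T -> R).
  by apply/funext => x /=; rewrite mulr1.
by apply: uniform_closureZ; apply: sub_uniform_closure; case: algV.
Qed.

Lemma uniform_closureB u v : W u -> W v -> W (u \- v).
Proof.
move=> Wu Wv; have -> : u \- v = u \+ (fun x => -1 * v x).
  by apply/funext => x /=; rewrite mulN1r.
by apply: uniform_closureD => //; exact: uniform_closureZ.
Qed.

Lemma abs_approx_subalgebra u n : V u -> V (fun x => abs_approx (u x) n).
Proof.
case: algV => V1 VZ VD VM Vu; elim: n => [|n IH].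
  suff -> : (fun x => abs_approx (u x) 0) = (fun x => 0 * cst 1 x) by exact: VZ.
  by apply/funext => x /=; rewrite mul0r.
pose p x := abs_approx (u x) n.
suff -> : (fun x => abs_approx (u x) n.+1) =
    p \+ (fun x => 2^-1 * ((u \* u) \+ (fun y => -1 * (p \* p) y)) x).
  by apply: (VD) => //; apply: (VZ); apply: (VD); [|apply: (VZ)]; exact: VM.
by apply/funext => x /=; rewrite /p !expr2; field.
Qed.

(** Approximate [u] by [v] in the algebra, rescale [v] into [-1, 1], and apply the polynomials
    [abs_approx] to it. *)
Lemma uniform_closure_norm u : W u -> W (fun x => `|u x|).
Proof.
move=> Wu e e0; have e20 : 0 < e / 2 by lra.
have [v Vv uv] := Wu _ e20; have [M0 vM0] := bndV Vv.
(* Adding 1 makes the bound positive, so that it can be divided by. *)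
pose M := `|M0| + 1; have M_gt0 : 0 < M by rewrite ltr_pwDr.
have vM x : `|v x| <= M.
  by rewrite (le_trans (vM0 x))// (le_trans (ler_norm _))// lerDl.
(* After scaling back by [M], the polynomial error is at most [2 * M / (n + 1)]; this [n] brings it
   below [e / 2]. *)
pose n := Num.truncn (M * 2 / (e / 2)).
have nM : M * 2 / n.+1%:R <= e / 2.
  rewrite ler_pdivrMr// [leRHS]mulrC -ler_pdivrMr//.
  by rewrite ltW// Num.Theory.truncnS_gt.
case: (algV) => V1 VZ VD VM.
exists (fun x => M * abs_approx (M^-1 * v x) n) => [|x].
  by apply: (VZ); apply: abs_approx_subalgebra; exact: VZ.
have tM : `|M^-1 * v x| <= 1.
  by rewrite normrM gtr0_norm ?invr_gt0// mulrC ler_pdivrMr// mul1r.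
have -> : `|u x| - M * abs_approx (M^-1 * v x) n =
   (`|u x| - `|v x|) + M * (`|M^-1 * v x| - abs_approx (M^-1 * v x) n).
  rewrite normrM (gtr0_norm (_ : 0 < M^-1)) ?invr_gt0// mulrBr mulVKf ?gt_eqF//.
  by ring.
rewrite (le_trans (ler_normD _ _))// [leRHS]splitr lerD//.
  by rewrite (le_trans (ler_dist_dist _ _)).
apply: le_trans nM; rewrite normrM gtr0_norm// -mulrA (ler_wpM2l (ltW M_gt0))//.
have /andP[p0 pt] := abs_approx_itv n tM.
by rewrite [leLHS]ger0_norm ?subr_ge0// ler_pdivlMr// abs_approx_error.
Qed.

Lemma uniform_closure_max u v : W u -> W v -> W (fun x => Num.max (u x) (v x)).
Proof.
move=> Wu Wv; suff -> : (fun x => Num.max (u x) (v x)) =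
    (fun x => 2^-1 * ((u \+ v) \+ (fun y => `|(u \- v) y|)) x).
  apply: uniform_closureZ; apply: uniform_closureD; first exact: uniform_closureD.
  by apply: uniform_closure_norm; exact: uniform_closureB.
by apply/funext => x /=; rewrite maxr_absE mulrC.
Qed.

Lemma uniform_closure_min u v : W u -> W v -> W (fun x => Num.min (u x) (v x)).
Proof.
move=> Wu Wv; suff -> : (fun x => Num.min (u x) (v x)) =
    (fun x => 2^-1 * ((u \+ v) \- (fun y => `|(u \- v) y|)) x).
  apply: uniform_closureZ; apply: uniform_closureB; first exact: uniform_closureD.
  by apply: uniform_closure_norm; exact: uniform_closureB.
by apply/funext => x /=; rewrite minr_absE mulrC.
Qed.

Lemma uniform_closure_bounded u : W u -> exists M : R, forall x, `|u x| <= M.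
Proof.
move=> /(_ 1 ltr01)[v /bndV[M vM] uv]; exists (1 + M) => x.
by rewrite -[u x](subrK (v x)) (le_trans (ler_normD _ _))// lerD.
Qed.

End uniform_closure.

(** * Monotone approximation from below on a separable space *)

Section increasing_approximation.
Context {R : realType} {X : pmetricType R}.
Implicit Types (W : set (X -> R)) (u : X -> R) (x : X).

Definition peak u x (A : set X) :=
  [/\ forall y, 0 <= u y, 0 < u x & forall y, ~ A y -> u y = 0].

(** The sequence is the running maximum of a countable family of functions of [W] between 0 and [G].
    Continuity lets a function exceeding a level at a point do so on a whole basic ball, so
    countably many functions reach every level below [G] at every point. *)
Lemma separable_approximation W (G : X -> R) : separable X ->
  W `<=` [set u | continuous u] ->
  W (cst 0) ->
  (forall u v, W u -> W v -> W (fun x => Num.max (u x) (v x))) ->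
  (forall x q, 0 <= q < G x -> exists u,
     [/\ W u, forall y, 0 <= u y <= G y & q < u x]) ->
  (forall x, 0 <= G x) ->
  exists v : nat -> X -> R, [/\ forall n, W (v n),
    forall n x, 0 <= v n x <= G x &
    forall x, v n x @[n --> \oo] --> G x].
Proof.
move=> [D /pcard_surjP[d dD] denseD] Wcont W0 Wmax WG G0.
(* Countability: only basic balls and rational levels are used, one function
   being chosen for each pair that admits one. *)
pose P (j : nat * nat * rat) u := [/\ W u, forall y, 0 <= u y <= G y &
  forall y, ball (d j.1.1) j.1.2.+1%:R^-1 y -> ratr j.2 < u y].
have /choice[w wP] : forall j, exists u,
    [/\ W u, forall y, 0 <= u y <= G y & (exists u, P j u) -> P j u].
  move=> j; have [[u Pu]|nP] := pselect (exists u, P j u).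
    by exists u; case: (Pu).
  by exists (cst 0); split => //= y; rewrite lexx G0.
pose t n := if unpickle n is Some j then w j else cst 0.
have Wt n : W (t n) by rewrite /t; case: unpickle => // j; case: (wP j).
have tG n y : 0 <= t n y <= G y.
  by rewrite /t; case: unpickle => [j|/=]; [case: (wP j)|rewrite lexx G0].
pose v := fix v n y : R := if n is m.+1 then Num.max (v m y) (t m y) else 0.
have vG n y : 0 <= v n y <= G y.
  elim: n => [|n /andP[v0 vG]]/=; first by rewrite lexx G0.
  by have /andP[t0 t1] := tG n y; rewrite le_max v0/= ge_max vG t1.
have vS y : {homo v ^~ y : n m / (n <= m)%N >-> n <= m}.
  apply: homo_leq => [//|a b c|n]; first exact: le_trans.
  by rewrite /= le_max lexx.
exists v; split => // [|x].
  by elim=> [|n IH] //=; apply: Wmax.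
apply/cvgrPdist_le => e e0.
suff [n vn] : exists n, G x - e <= v n x.
  near=> m; have /andP[vm0 vmG] := vG m x.
  rewrite ger0_norm ?subr_ge0// lerBlDl -lerBlDr (le_trans vn)//.
  by apply: vS; near: m; exact: nbhs_infty_ge.
have [Ge|Ge] := leP (G x) e; first by exists 0%N; rewrite /= subr_le0.
have : G x - e < G x by rewrite gtrBl.
move=> /rat_in_itvoo[q]; rewrite in_itv/= => /andP[eq qG].
have q0 : 0 <= ratr q :> R by rewrite ltW// (le_lt_trans _ eq)// subr_ge0 ltW.
have [u [Wu u0G qu]] : exists u, [/\ W u, forall y, 0 <= u y <= G y &
    ratr q < u x] by apply: WG; rewrite q0.
have : \forall y \near x, ratr q < u y.
  by apply: (cvgr_gt (u x)) => //; exact: Wcont.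
move=> /nbhs_ballP[r /= r0 ru].
(* With this radius, a ball centred at a dense point that is within the radius of [x] stays inside
   the ball of radius [r] around [x]. *)
have [m mr] : exists m : nat, m.+1%:R^-1 < r / 2.
  exists (Num.truncn (r / 2)^-1).
  rewrite -[ltRHS]invrK ltf_pV2 ?posrE ?invr_gt0 ?divr_gt0//.
  exact: Num.Theory.truncnS_gt.
(* Density speaks of open sets, so the ball is replaced by its interior. *)
have : open_nbhs x (ball x m.+1%:R^-1 : set X)^°.
  split; first exact: open_interior.
  by apply: nbhsx_ballx; rewrite invr_gt0.
case=> oB xB; have [z [zB]] := denseD _ (ex_intro _ _ xB) oB.
move=> /dD[i _ dz].
have Pu : P (i, m, q) u.
  split => //= y; rewrite dz => zy; apply: ru.
  apply: (@le_ball _ _ _ (m.+1%:R^-1 + m.+1%:R^-1)).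
    by rewrite [leRHS]splitr lerD// ltW.
  by apply: ball_triangle zy; exact: interior_subset.
(* The successor is needed because [t n] first enters the maximum in [v n.+1]. *)
exists (pickle (i, m, q)).+1; rewrite /= le_max.
apply/orP; right; rewrite /t pickleK ltW// (lt_trans eq)//.
have [_ _ /(_ (ex_intro _ _ Pu))[_ _]] := wP (i, m, q); apply => /=.
by apply: ball_sym; rewrite dz; exact: interior_subset.
Unshelve. all: by end_near. Qed.

(** Choose [s] between [q] and [G x], take a peak at [x] inside the set where [G > s], scale it to
    the value [s] at [x] and truncate it at [s]: it stays below [G] where [G > s] and vanishes
    elsewhere. *)
Lemma peak_below W (G : X -> R) : continuous G ->
  (forall a, W (cst a)) ->
  (forall a u, W u -> W (fun x => a * u x)) ->
  (forall u v, W u -> W v -> W (fun x => Num.min (u x) (v x))) ->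
  (forall x A, nbhs x A -> exists2 u, W u & peak u x A) ->
  (forall x, 0 <= G x) ->
  forall x q, 0 <= q < G x -> exists u,
     [/\ W u, forall y, 0 <= u y <= G y & q < u x].
Proof.
move=> cG Wcst WZ Wmin Wpeak G0 x q /andP[q0 qG].
have [s qs sG] : exists2 s, q < s & s < G x.
  by exists ((q + G x) / 2); lra.
have s0 : 0 < s by exact: le_lt_trans qs.
have [u Wu [u0 ux uA]] := Wpeak x _ (cvgr_gt (G x) (cG x) s sG).
exists (fun y => Num.min s (s / u x * u y)); split => [|y|].
- by apply: (Wmin (cst s)); [exact: Wcst|exact: WZ].
- rewrite le_min (ltW s0)/= mulr_ge0 ?(divr_ge0 (ltW s0) (ltW ux))//=.
  have [sy|sy] := ltP s (G y).
    by rewrite ge_min (ltW sy).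
  have -> : u y = 0 by apply: uA; apply/negP; rewrite -leNgt.
  by rewrite mulr0 ge_min G0 orbT.
- by rewrite divfK ?gt_eqF// minxx.
Qed.

End increasing_approximation.

(** * Integration of bounded functions against a measure with density [h] *)

Section weighted_integrals.
Context d (T : measurableType d) (R : realType).
Implicit Types (nu : {measure set T -> \bar R}) (u v h : T -> R).

Definition bounded_measurable : set (T -> R) :=
  [set u : T -> R | measurable_fun setT u /\ exists M : R, forall x, `|u x| <= M].

Lemma bounded_measurable_cst a : bounded_measurable (cst a).
Proof. by split => //; exists `|a|. Qed.

Lemma bounded_measurableD u v : bounded_measurable u -> bounded_measurable v ->
  bounded_measurable (u \+ v).
Proof.
move=> [uu [M uM]] [mv [N vN]]; split; first exact: measurable_funD.
by exists (M + N) => x; rewrite (le_trans (ler_normD _ _))// lerD.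
Qed.

Lemma bounded_measurableZ a u : bounded_measurable u ->
  bounded_measurable (fun x => a * u x).
Proof.
move=> [mu [M uM]]; split; first exact: measurable_funM.
by exists (`|a| * M) => x; rewrite normrM ler_wpM2l.
Qed.

Lemma bounded_measurableB u v : bounded_measurable u -> bounded_measurable v ->
  bounded_measurable (u \- v).
Proof.
move=> bu bv; have -> : u \- v = u \+ (fun x => -1 * v x).
  by apply/funext => x /=; rewrite mulN1r.
by apply: bounded_measurableD => //; exact: bounded_measurableZ.
Qed.

Lemma integrable_bounded_mul nu u h : bounded_measurable u ->
  nu.-integrable setT (EFin \o h) -> nu.-integrable setT (EFin \o (u \* h)).
Proof.
move=> [mu [M uM]] hi.
have -> : EFin \o (u \* h) = ((EFin \o h) \* (EFin \o u))%E.
  by apply/funext => x /=; rewrite -EFinM mulrC.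
apply: integrableMl => //.
exists M; split; first exact: num_real.
by move=> y My x _ /=; rewrite (le_trans (uM x))// ltW.
Qed.

(** This is the integral of [u] against the measure [h nu], expressed without constructing that
    measure; its value at [cst 1] is the total mass. *)
Definition weighted_integral h nu u := \int[nu]_x (u \* h) x.

Section one_measure.
Variables (h : T -> R) (nu : {measure set T -> \bar R}).
Hypothesis nuh : nu.-integrable setT (EFin \o h).
Local Notation I := (weighted_integral h nu).

Lemma weighted_integralD u v : bounded_measurable u -> bounded_measurable v ->
  I (u \+ v) = I u + I v.
Proof.
move=> bu bv; rewrite -RintegralD//; [|exact: integrable_bounded_mul..].
by apply: eq_Rintegral => x _ /=; rewrite mulrDl.
Qed.

Lemma weighted_integralZ a u : bounded_measurable u ->
  I (fun x => a * u x) = a * I u.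
Proof.
move=> bu; rewrite -RintegralZl//; last exact: integrable_bounded_mul.
by apply: eq_Rintegral => x _ /=; rewrite mulrA.
Qed.

Lemma weighted_integralB u v : bounded_measurable u -> bounded_measurable v ->
  I (u \- v) = I u - I v.
Proof.
move=> bu bv; rewrite -RintegralB//; [|exact: integrable_bounded_mul..].
by apply: eq_Rintegral => x _ /=; rewrite mulrBl.
Qed.

Hypothesis h0 : forall x, 0 <= h x.

Lemma le_weighted_integral u v : bounded_measurable u -> bounded_measurable v ->
  (forall x, u x <= v x) -> I u <= I v.
Proof.
move=> bu bv uv; apply: le_Rintegral => //; [exact: integrable_bounded_mul..|].
by move=> x _ /=; rewrite ler_wpM2r.
Qed.

Lemma weighted_integral1_ge0 : 0 <= I (cst 1).
Proof. by apply: Rintegral_ge0 => x _ /=; rewrite mul1r. Qed.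

Lemma le_dist_weighted_integral u v e :
  bounded_measurable u -> bounded_measurable v ->
  (forall x, `|u x - v x| <= e) -> `|I u - I v| <= e * I (cst 1).
Proof.
move=> bu bv uv; rewrite -weighted_integralB//.
have be := bounded_measurable_cst e.
have -> : e * I (cst 1) = I (cst e).
  rewrite -weighted_integralZ; last exact: bounded_measurable_cst.
  by congr I; apply/funext => x /=; rewrite mulr1.
rewrite ler_norml; apply/andP; split.
  rewrite -mulN1r -weighted_integralZ//; apply: le_weighted_integral => [||x].
  - exact: bounded_measurableZ.
  - exact: bounded_measurableB.
  - by have := uv x; rewrite ler_norml mulN1r => /andP[].
apply: le_weighted_integral => [||x] //.
- exact: bounded_measurableB.
- by have := uv x; rewrite ler_norml => /andP[].
Qed.

Lemma cvg_weighted_integral (v : nat -> T -> R) G :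
  (forall n, bounded_measurable (v n)) -> bounded_measurable G ->
  (forall n x, 0 <= v n x <= G x) ->
  (forall x, v n x @[n --> \oo] --> G x) ->
  I (v n) @[n --> \oo] --> I G.
Proof.
move=> bv bG vG cvG.
have [|||||_ _ +] := @dominated_convergence _ _ _ nu setT measurableT
    (fun n => EFin \o (v n \* h)) (EFin \o (G \* h)) (EFin \o (G \* h)).
- by move=> n; have /integrableP[] := integrable_bounded_mul (bv n) nuh.
- by have /integrableP[] := integrable_bounded_mul bG nuh.
- apply: aeW => x _; apply: cvg_EFin; first by near=> n.
  by apply: cvgM; [exact: cvG|exact: cvg_cst].
- exact: integrable_bounded_mul.
- apply: aeW => x n _ /=; have /andP[v0 vGx] := vG n x.
  by rewrite lee_fin ger0_norm ?mulr_ge0// ler_wpM2r.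
have fG : integral nu setT (EFin \o (G \* h)) \is a fin_num.
  by apply: integrable_fin_num => //; exact: integrable_bounded_mul.
by rewrite -(fineK fG) => /fine_cvgP[].
Unshelve. all: by end_near. Qed.

End one_measure.

Section sequence_of_measures.
Variables (h : T -> R).
Variables (mu_ : nat -> {measure set T -> \bar R}) (mu : {measure set T -> \bar R}).
Hypothesis mu_h : forall n, (mu_ n).-integrable setT (EFin \o h).
Hypothesis muh : mu.-integrable setT (EFin \o h).
Hypothesis h0 : forall x, 0 <= h x.
Local Notation I := (weighted_integral h).

Definition weighted_cvg u := I (mu_ n) u @[n --> \oo] --> I mu u.

Lemma weighted_cvgD u v : bounded_measurable u -> bounded_measurable v ->
  weighted_cvg u -> weighted_cvg v -> weighted_cvg (u \+ v).
Proof.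
move=> bu bv cu cv; rewrite /weighted_cvg weighted_integralD//.
under eq_cvg do rewrite weighted_integralD//.
exact: cvgD.
Qed.

Lemma weighted_cvgZ a u : bounded_measurable u ->
  weighted_cvg u -> weighted_cvg (fun x => a * u x).
Proof.
move=> bu cu; rewrite /weighted_cvg weighted_integralZ//.
under eq_cvg do rewrite weighted_integralZ//.
by apply: cvgM => //; exact: cvg_cst.
Qed.

Hypothesis cvg1 : weighted_cvg (cst 1).

(** The convergence [cvg1] bounds the masses of the weighted measures eventually, so the error of a
    uniform approximation is controlled uniformly in [n]. *)
Lemma weighted_cvg_uniform u : bounded_measurable u ->
  (forall e : R, 0 < e -> exists v, [/\ bounded_measurable v, weighted_cvg v &
     forall x, `|u x - v x| <= e]) ->
  weighted_cvg u.
Proof.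
move=> bu uV; apply/cvgrPdist_le => e e0.
(* The added 1 leaves room for the masses of the [h mu_n], which only converge to that of [h mu],
   and makes [K] positive. *)
pose K := I mu (cst 1) + 1.
have K0 : 0 < K by rewrite ltr_pwDr// weighted_integral1_ge0.
have e'0 : 0 < e / 3 / K by rewrite !divr_gt0.
have [v [bv cv uv]] := uV _ e'0.
have e30 : 0 < e / 3 by rewrite divr_gt0.
near=> n.
have -> : I mu u - I (mu_ n) u = (I mu u - I mu v) + (I mu v - I (mu_ n) v)
   + (I (mu_ n) v - I (mu_ n) u) by ring.
have -> : e = e / 3 + e / 3 + e / 3 by field.
have bound nu : nu.-integrable setT (EFin \o h) -> I nu (cst 1) <= K ->
    `|I nu u - I nu v| <= e / 3.
  move=> nuh nuK; rewrite (le_trans (le_dist_weighted_integral nuh h0 bu bv uv))//.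
  rewrite mulrAC ler_pdivrMr//.
  by apply: ler_wpM2l => //; exact: ltW.
rewrite (le_trans (ler_normD _ _))// lerD//.
  rewrite (le_trans (ler_normD _ _))// lerD//.
    by apply: bound => //; rewrite lerDl.
  by near: n; move/cvgrPdist_le : cv; exact.
rewrite distrC; apply: bound => //.
near: n; apply: (cvgr_le _ cvg1); rewrite /K ltrDl//.
Unshelve. all: by end_near. Qed.

(** Dominated convergence gives a [k] for which [I mu (v k)] is close to [I mu G]. For this fixed
    [k], [I (mu_ n) G] dominates [I (mu_ n) (v k)], which converges to [I mu (v k)]. *)
Lemma weighted_cvg_liminf (v : nat -> T -> R) G :
  (forall n, bounded_measurable (v n)) -> bounded_measurable G ->
  (forall n, weighted_cvg (v n)) ->
  (forall n x, 0 <= v n x <= G x) ->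
  (forall x, v n x @[n --> \oo] --> G x) ->
  forall e : R, 0 < e -> \forall n \near \oo, I mu G - e <= I (mu_ n) G.
Proof.
move=> bv bG cv vG vcvG e e0.
have e20 : 0 < e / 2 by rewrite divr_gt0.
have /cvgrPdist_le/(_ _ e20)[k _ /(_ _ (leqnn k))/=] :=
  cvg_weighted_integral muh h0 bv bG vG vcvG.
rewrite ler_distlC => /andP[vk _].
near=> n; apply: (@le_trans _ _ (I (mu_ n) (v k))); last first.
  by apply: le_weighted_integral => // x; case/andP: (vG k x).
have : `|I mu (v k) - I (mu_ n) (v k)| <= e / 2.
  by near: n; have /cvgrPdist_le := cv k; exact.
by rewrite ler_distlC => /andP[+ _]; lra.
Unshelve. all: by end_near. Qed.

End sequence_of_measures.
End weighted_integrals.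

(** * Real and imaginary parts, and the modulus as a real number *)

Section complex_parts.
Context {R : realType}.

Lemma ltc_norm (z : R[i]) (e : R) : (`|z| < e%:C%C) = (Normc.normc z < e).
Proof. by rewrite normc_def ltcR; case: z. Qed.

Lemma norm_Re_le (z : R[i]) : `|complex.Re z| <= Normc.normc z.
Proof. by have := normc_ge_Re z; rewrite normc_def lecR; case: z. Qed.

Lemma norm_Im_le (z : R[i]) : `|complex.Im z| <= Normc.normc z.
Proof.
case: z => a b /=; rewrite -sqrtr_sqr ler_wsqrtr// lerDr sqr_ge0//.
Qed.

Lemma normc_le_ReIm (z : R[i]) :
  Normc.normc z <= `|complex.Re z| + `|complex.Im z|.
Proof.
case: z => a b /=; rewrite -[leRHS]ger0_norm ?addr_ge0// -sqrtr_sqr.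
rewrite ler_wsqrtr// sqrrD !real_normK ?num_real//.
by rewrite lerD2r lerDl mulrn_wge0// mulr_ge0.
Qed.

(** A radius that is positive in the order of [R[i]] has zero imaginary part, so it is a positive
    real. *)
Lemma nbhs_normc (z : R[i]) (A : set R[i]) : nbhs z A ->
  exists2 e : R, 0 < e & forall w, Normc.normc (z - w) < e -> A w.
Proof.
move=> /nbhs_ballP[[a b]] /=; rewrite ltcE/= => /andP[/eqP -> a0] zA.
by exists a => // w zw; apply: zA; rewrite -ball_normE/= ltc_norm.
Qed.

Lemma bounded_fun_normc (T : Type) (f : T -> R[i]) : bounded_fun f ->
  exists M : R, forall x, Normc.normc (f x) <= M.
Proof.
move=> [M [_ fM]]; exists (complex.Re (M + 1)) => x.
have /fM/(_ x I) : M < M + 1 by rewrite ltrDl.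
by rewrite /= [`|_|]normc_def lecE => /andP[_]; case: (f x).
Qed.

Context {T : Type} {G : set_system T} {FG : Filter G}.

Lemma cvg_Re (f : T -> R[i]) (l : R[i]) : f x @[x --> G] --> l ->
  complex.Re (f x) @[x --> G] --> complex.Re l.
Proof.
move=> /cvgrPdist_lt fl; apply/cvgrPdist_lt => e e0.
have /fl : 0 < e%:C%C :> R[i] by rewrite ltcR.
apply: filterS => x; rewrite ltc_norm.
by apply: le_lt_trans; rewrite -raddfB; exact: norm_Re_le.
Qed.

Lemma cvg_Im (f : T -> R[i]) (l : R[i]) : f x @[x --> G] --> l ->
  complex.Im (f x) @[x --> G] --> complex.Im l.
Proof.
move=> /cvgrPdist_lt fl; apply/cvgrPdist_lt => e e0.
have /fl : 0 < e%:C%C :> R[i] by rewrite ltcR.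
apply: filterS => x; rewrite ltc_norm.
by apply: le_lt_trans; rewrite -raddfB; exact: norm_Im_le.
Qed.

End complex_parts.


(** * The real algebra generated by [F] and its peak functions *)

Section real_parts.
Context {R : realType} {X : pmetricType R} (F : set (X -> R[i])).

(** The constant 1 is a generator although [F] may contain no constant: its integral against [h nu]
    is that of the weight, which comes from a function of [F]. *)
Inductive real_span : (X -> R) -> Prop :=
| real_span_cst1 : real_span (cst 1)
| real_span_Re f : F f -> real_span (fun x => complex.Re (f x))
| real_span_Im f : F f -> real_span (fun x => complex.Im (f x))
| real_spanZ a u : real_span u -> real_span (fun x => a * u x)
| real_spanD u v : real_span u -> real_span v -> real_span (u \+ v).

Hypothesis F_Cb : F `<=` @bounded_continuous R X.

Lemma real_span_bounded u : real_span u -> exists M : R, forall x, `|u x| <= M.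
Proof.
elim=> [|f /F_Cb[_ /bounded_fun_normc[M fM]]|f /F_Cb[_ /bounded_fun_normc[M fM]]
  |a {}u _ [M uM]|{}u v _ [M uM] _ [N vN]].
- by exists 1 => x; rewrite /= normr1.
- by exists M => x; apply: le_trans (fM x); exact: norm_Re_le.
- by exists M => x; apply: le_trans (fM x); exact: norm_Im_le.
- by exists (`|a| * M) => x; rewrite normrM ler_wpM2l.
- by exists (M + N) => x; rewrite (le_trans (ler_normD _ _))// lerD.
Qed.

Lemma real_span_continuous u : real_span u -> continuous u.
Proof.
elim=> [|f /F_Cb[cf _]|f /F_Cb[cf _]|a {}u _ cu|{}u v _ cu _ cv] x.
- exact: cvg_cst.
- by apply: cvg_Re; exact: cf.
- by apply: cvg_Im; exact: cf.
- by apply: cvgM; [exact: cvg_cst|exact: cu].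
- by apply: cvgD; [exact: cu|exact: cv].
Qed.

Hypothesis T1_mul : mult_closed F.
Hypothesis T1_conj : conj_closed F.

(* [2 Re f Re g = Re (f g) + Re (f g^* )], and similarly for the other products of
   generators. *)
Lemma real_spanM u v : real_span u -> real_span v -> real_span (u \* v).
Proof.
have spanB u' v' : real_span u' -> real_span v' -> real_span (u' \- v').
  move=> su sv; have -> : u' \- v' = u' \+ (fun x => -1 * v' x).
    by apply/funext => x /=; rewrite mulN1r.
  by apply: real_spanD => //; exact: real_spanZ.
have span_eq w w' : real_span w -> w' =1 w -> real_span w'.
  by move=> sw /funext ->.
have FM f g : F f -> F g -> F (f \* g) /\ F (f \* (fun x => (g x)^*%C)).
  by move=> Ff Fg; split; apply: T1_mul => //; exact: T1_conj.
move=> su sv; elim: su => [|f Ff|f Ff|a {}u _ IH|{}u w _ IHu _ IHw].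
- by apply: span_eq sv _ => x /=; rewrite mul1r.
- elim: sv => [|g Fg|g Fg|a {}v _ IH|{}v w _ IHv _ IHw].
  + by apply: span_eq (real_span_Re Ff) _ => x /=; rewrite mulr1.
  + have [fg fg'] := FM _ _ Ff Fg.
    apply: span_eq (real_spanZ 2^-1 (real_spanD
      (real_span_Re fg) (real_span_Re fg'))) _ => x /=.
    by case: (f x) (g x) => [? ?] [? ?] /=; field.
  + have [fg fg'] := FM _ _ Ff Fg.
    apply: span_eq (real_spanZ 2^-1 (spanB _ _
      (real_span_Im fg) (real_span_Im fg'))) _ => x /=.
    by case: (f x) (g x) => [? ?] [? ?] /=; field.
  + by apply: span_eq (real_spanZ a IH) _ => x /=; rewrite mulrCA.
  + by apply: span_eq (real_spanD IHv IHw) _ => x /=; rewrite mulrDr.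
- elim: sv => [|g Fg|g Fg|a {}v _ IH|{}v w _ IHv _ IHw].
  + by apply: span_eq (real_span_Im Ff) _ => x /=; rewrite mulr1.
  + have [fg fg'] := FM _ _ Ff Fg.
    apply: span_eq (real_spanZ 2^-1 (real_spanD
      (real_span_Im fg) (real_span_Im fg'))) _ => x /=.
    by case: (f x) (g x) => [? ?] [? ?] /=; field.
  + have [fg fg'] := FM _ _ Ff Fg.
    apply: span_eq (real_spanZ 2^-1 (spanB _ _
      (real_span_Re fg') (real_span_Re fg))) _ => x /=.
    by case: (f x) (g x) => [? ?] [? ?] /=; field.
  + by apply: span_eq (real_spanZ a IH) _ => x /=; rewrite mulrCA.
  + by apply: span_eq (real_spanD IHv IHw) _ => x /=; rewrite mulrDr.
- by apply: span_eq (real_spanZ a IH) _ => x /=; rewrite mulrA.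
- by apply: span_eq (real_spanD IHu IHw) _ => x /=; rewrite mulrDl.
Qed.

Lemma real_span_subalgebra : subalgebra real_span.
Proof.
split; [exact: real_span_cst1|exact: real_spanZ|exact: real_spanD|].
exact: real_spanM.
Qed.

Local Notation W := (uniform_closure real_span).

Lemma uniform_closure_continuous u : W u -> continuous u.
Proof.
move=> Wu x; apply/cvgrPdist_le => e e0.
have e30 : 0 < e / 3 by rewrite divr_gt0.
have [v /real_span_continuous cv uv] := Wu _ e30.
near=> y.
have -> : u x - u y = (u x - v x) + (v x - v y) + (v y - u y) by ring.
have -> : e = e / 3 + e / 3 + e / 3 by field.
rewrite (le_trans (ler_normD _ _))// lerD//; last by rewrite distrC.
rewrite (le_trans (ler_normD _ _))// lerD//.
by near: y; have /cvgrPdist_le := cv x; exact.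
Unshelve. all: by end_near. Qed.

(* [peak_filter x] is a filter, so by the universal property of the initial
   topology its convergence to [x] need only be tested on each [f] in [F]. *)
Let peak_filter (x : X) : set_system X :=
  [set A | exists2 u, W u & peak u x A].

(** The minimum of a peak for [A] and a peak for [B] is a peak for their intersection. *)
Let peak_filter_filter x : Filter (peak_filter x).
Proof.
have Wcst := uniform_closure_cst real_span_subalgebra.
have Wmin := uniform_closure_min real_span_subalgebra real_span_bounded.
split=> [|A B [u Wu [u0 ux uA]] [v Wv [v0 vx vB]]|A B AB [u Wu [u0 ux uA]]].
- by exists (cst 1); [exact: Wcst|split=> //= y []].
- exists (fun y => Num.min (u y) (v y)); first exact: Wmin.
  split=> [y||y /not_andP[/uA ->|/vB ->]]; first by rewrite le_min u0 v0.
  + by rewrite lt_min ux vx.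
  + by rewrite min_l.
  + by rewrite min_r.
- by exists u => //; split=> // y By; apply: uA => /AB.
Qed.

Hypothesis T2 : induces_topology F.

Lemma peak_nbhs x A : nbhs x A -> exists2 u, W u & peak u x A.
Proof.
move=> xA; change (peak_filter x A).
have alg := real_span_subalgebra; have bnd := real_span_bounded.
have Wcst := uniform_closure_cst alg.
have WB := uniform_closureB alg.
have WDD := uniform_closureD alg.
have WZ := uniform_closureZ alg.
have Wnorm := uniform_closure_norm alg bnd.
have Wmax := uniform_closure_max alg bnd.
have : peak_filter x --> (x : sup_topology (fun f : {f | F f} =>
    Topological.class (initial_topology (sval f)))).
  apply/(@cvg_sup _ _ _ _ _ (peak_filter_filter x)) => -[f Ff] B.
  rewrite nbhsE => -[_ [[U oU <-] /= Ux] UB].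
  have [e e0 eU] := nbhs_normc (open_nbhs_nbhs (conj oU Ux)).
  pose D (g : R[i] -> R) y := `|g (f y) - g (f x)|.
  have WD g : real_span (fun y => g (f y)) -> W (D g).
    move=> sg; apply: Wnorm; apply: (WB (fun y => g (f y)) (cst (g (f x)))).
      exact: sub_uniform_closure.
    exact: Wcst.
  pose s y := D (@complex.Re R) y + D (@complex.Im R) y.
  have Ws : W (fun y => e^-1 * s y).
    apply: WZ; apply: (WDD (D (@complex.Re R)) (D (@complex.Im R))).
      by apply: WD; exact: real_span_Re.
    by apply: WD; exact: real_span_Im.
  (* This function is 1 at [x] and vanishes once [s y >= e]. Since [s y] dominates the modulus of
     [f y - f x], a point with [s y < e] is mapped into [U] and so lies in [B]. *)
  exists (fun y => Num.max 0 (1 - e^-1 * s y)).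
    by apply: (Wmax (cst 0)); [exact: Wcst|apply: (WB (cst 1)) => //; exact: Wcst].
  split=> [y||y nBy].
  - by rewrite le_max lexx.
  - by rewrite /s /D !subrr !normr0 addr0 mulr0 subr0 lt_max ltr01 orbT.
  - rewrite max_l// subr_le0 mulrC ler_pdivlMr// mul1r leNgt; apply/negP => sye.
    apply: nBy; apply: UB; apply: eU; apply: le_lt_trans sye.
    rewrite (le_trans (normc_le_ReIm _))// !raddfB/= /s /D.
    by rewrite lerD// distrC.
apply; rewrite nbhsE; move: xA; rewrite nbhsE => -[B [oB xB] BA].
by exists B => //; split=> //; move: oB; rewrite T2.
Qed.

End real_parts.

(** * Weak convergence of the measures with density [h] *)

Section weak_sharp_convergence.
Context {R : realType} {X : pmetricType R}.
Local Notation borelX := (g_sigma_algebraType (@open X)).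
Implicit Types (G : X -> R) (nu : {measure set borelX -> \bar R}).

Lemma continuous_measurable G : continuous G ->
  measurable_fun setT (G : borelX -> R).
Proof.
move=> /continuousP cG; apply: (measurability _ (RGenOpens.measurableE R)).
move=> _ [_ [a [b ->] <-]]; rewrite setTI; apply: sub_sigma_algebra.
by apply: cG; exact: interval_open.
Qed.

Lemma continuous_bounded_measurable G : continuous G ->
  (exists M : R, forall x, `|G x| <= M) ->
  @bounded_measurable _ borelX R G.
Proof. by move=> cG bG; split=> //; exact: continuous_measurable. Qed.

Section convergence_determining.
Variables (F : set (X -> R[i])).
Hypothesis sepX : separable X.
Hypothesis F_Cb : F `<=` @bounded_continuous R X.
Hypotheses (T1_mul : mult_closed F) (T1_conj : conj_closed F).
Hypothesis T2 : induces_topology F.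
Variables (mu_ : nat -> {measure set borelX -> \bar R}).
Variables (mu : {measure set borelX -> \bar R}) (k : X -> R[i]).
Let h x := complex.Re (k x).
Hypothesis Fk : F k.
Hypothesis k0 : forall x, 0 <= k x.
Hypothesis mu_h : forall n, (mu_ n).-integrable setT (EFin \o (h : borelX -> R)).
Hypothesis muh : mu.-integrable setT (EFin \o (h : borelX -> R)).
Hypothesis cvgF : forall f, F f ->
  cintegral (mu_ n) f @[n --> \oo] --> cintegral mu f.

Local Notation W := (uniform_closure (real_span F)).
Local Notation bounded_measurable := (@bounded_measurable _ borelX R).
Local Notation weighted_cvg := (@weighted_cvg _ borelX R h mu_ mu).
Local Notation I := (@weighted_integral _ borelX R h).

Let h0 x : 0 <= h x.
Proof. by have := k0 x; rewrite lecE => /andP[_]. Qed.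

(** In the order of [R[i]], being nonnegative includes being real. *)
Let Im_k x : complex.Im (k x) = 0.
Proof. by have := k0 x; rewrite lecE => /andP[/eqP]. Qed.

Lemma real_span_bounded_measurable u : real_span F u -> bounded_measurable u.
Proof.
move=> su; apply: continuous_bounded_measurable.
  exact: real_span_continuous su.
exact: real_span_bounded su.
Qed.

Lemma uniform_closure_bounded_measurable u : W u -> bounded_measurable u.
Proof.
move=> Wu; apply: continuous_bounded_measurable.
  exact: uniform_closure_continuous Wu.
by apply: uniform_closure_bounded Wu; exact: real_span_bounded.
Qed.

(** As [k] is real, [Re f * h = Re (f k)] and [Im f * h = Im (f k)], and [f k] is again in [F],
    where convergence is assumed. For the constant 1 the relevant function is [k] itself. *)
Lemma real_span_weighted_cvg u : real_span F u -> weighted_cvg u.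
Proof.
elim=> [|f Ff|f Ff|a {}u su cu|{}u v su cu sv cv].
- have E nu : I nu (cst 1) = complex.Re (cintegral nu k).
    by apply: eq_Rintegral => x _ /=; rewrite mul1r.
  rewrite /weighted_cvg E; under eq_cvg do rewrite E.
  by apply: cvg_Re; exact: cvgF.
- have E nu : I nu (fun x => complex.Re (f x)) =
      complex.Re (cintegral nu (f \* k)).
    apply: eq_Rintegral => x _ /=; rewrite /h; have := Im_k x.
    by case: (f x) (k x) => [? ?] [? ?] /= ->; rewrite mulr0 subr0.
  rewrite /weighted_cvg E; under eq_cvg do rewrite E.
  by apply: cvg_Re; apply: cvgF; exact: T1_mul.
- have E nu : I nu (fun x => complex.Im (f x)) =
      complex.Im (cintegral nu (f \* k)).
    apply: eq_Rintegral => x _ /=; rewrite /h; have := Im_k x.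
    by case: (f x) (k x) => [? ?] [? ?] /= ->; rewrite mulr0 add0r.
  rewrite /weighted_cvg E; under eq_cvg do rewrite E.
  by apply: cvg_Im; apply: cvgF; exact: T1_mul.
- by apply: weighted_cvgZ => //; exact: real_span_bounded_measurable.
- by apply: weighted_cvgD => //; exact: real_span_bounded_measurable.
Qed.

Let cvg1 : weighted_cvg (cst 1).
Proof. by apply: real_span_weighted_cvg; exact: real_span_cst1. Qed.

Lemma uniform_closure_weighted_cvg u : W u -> weighted_cvg u.
Proof.
move=> Wu; apply: weighted_cvg_uniform => //.
  exact: uniform_closure_bounded_measurable.
move=> e /Wu[v sv uv]; exists v; split=> //.
- exact: real_span_bounded_measurable.
- exact: real_span_weighted_cvg.
Qed.

Lemma nonneg_weighted_liminf G : continuous G ->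
  (exists M : R, forall x, `|G x| <= M) -> (forall x, 0 <= G x) ->
  forall e : R, 0 < e -> \forall n \near \oo, I mu G - e <= I (mu_ n) G.
Proof.
move=> cG bG G0 e e0.
have alg := real_span_subalgebra T1_mul T1_conj.
have bnd := real_span_bounded F_Cb.
have Wcst := uniform_closure_cst alg.
have WZ := uniform_closureZ alg.
have Wmin := uniform_closure_min alg bnd.
have Wmax := uniform_closure_max alg bnd.
have Wpeak x A := peak_nbhs F_Cb T1_mul T1_conj T2 (x := x) (A := A).
have WG := peak_below cG Wcst WZ Wmin Wpeak G0.
have [v [Wv vG cvG]] := separable_approximation sepX
  (uniform_closure_continuous F_Cb) (Wcst 0) Wmax WG G0.
apply: (@weighted_cvg_liminf _ borelX R h mu_ mu mu_h muh h0 v) => //.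
- by move=> n; exact: uniform_closure_bounded_measurable.
- exact: continuous_bounded_measurable.
- by move=> n; exact: uniform_closure_weighted_cvg.
Qed.

Lemma bounded_continuous_weighted_cvg G : continuous G ->
  (exists M : R, forall x, `|G x| <= M) -> weighted_cvg G.
Proof.
move=> cG [M GM]; have bG : bounded_measurable G.
  by apply: continuous_bounded_measurable => //; exists M.
(* The signs [s = 1] and [s = -1] treat [M + G] and [M - G] together; the contribution of [M] is
   removed by the convergence of the masses. *)
have shift s : `|s| = 1 -> forall e : R, 0 < e -> \forall n \near \oo,
    s * I mu G - e <= s * I (mu_ n) G.
  move=> s1 e e0.
  have bsG := bounded_measurableZ s bG.
  have bM := @bounded_measurable_cst _ borelX R M.
  have E nu : nu.-integrable setT (EFin \o (h : borelX -> R)) ->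
      I nu (cst M \+ (fun x => s * G x)) =
      M * I nu (cst 1) + s * I nu G.
    move=> nuh; rewrite weighted_integralD// weighted_integralZ//; congr (_ + _).
    rewrite -weighted_integralZ//; last exact: bounded_measurable_cst.
    by apply: eq_Rintegral => x _ /=; rewrite mulr1.
  have e20 : 0 < e / 2 by rewrite divr_gt0.
  have lim : \forall n \near \oo,
      I mu (cst M \+ (fun x => s * G x)) - e / 2 <=
      I (mu_ n) (cst M \+ (fun x => s * G x)).
    apply: nonneg_weighted_liminf => //.
    - move=> x; apply: cvgD; first exact: cvg_cst.
      by apply: cvgM; [exact: cvg_cst|exact: cG].
    - exists (M + M) => x; rewrite (le_trans (ler_normD _ _))//= normrM s1 mul1r.
      by rewrite lerD// ger0_norm// (le_trans _ (GM x)).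
    - move=> x /=; rewrite -lerBlDl sub0r lerNl (le_trans _ (GM x))//.
      by rewrite -[leRHS]mul1r -s1 -normrM -normrN ler_norm.
  have cM : M * I (mu_ n) (cst 1) @[n --> \oo] --> M * I mu (cst 1).
    by apply: cvgM => //; exact: cvg_cst.
  near=> n.
  have : I mu (cst M \+ (fun x => s * G x)) - e / 2 <=
      I (mu_ n) (cst M \+ (fun x => s * G x)).
    by near: n.
  have : `|M * I mu (cst 1) - M * I (mu_ n) (cst 1)| <= e / 2.
    by near: n; move/cvgrPdist_le : cM; exact.
  by rewrite !E// ler_distlC => /andP[_]; lra.
apply/cvgrPdist_le => e e0; near=> n.
rewrite ler_distlC; apply/andP; split.
  rewrite -[X in X - _]mul1r -[leRHS]mul1r.
  by near: n; apply: shift => //; rewrite normr1.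
rewrite -lerN2 opprD -mulN1r -[leRHS]mulN1r.
by near: n; apply: shift => //; rewrite normrN1.
Unshelve. all: by end_near. Qed.

End convergence_determining.
End weak_sharp_convergence.

(** * Reduction of test functions with bounded support to weighted integrals *)

Unset Implicit Arguments.
Set Strict Implicit.

Theorem theorem2p3 (R : realType) (X : pmetricType R) (F : set (X -> R[i]))
    (sepX : separable X)
    (F_Cb : F `<=` @bounded_continuous R X)
    (T1_mul : mult_closed F) (T1_conj : conj_closed F)
    (T2 : induces_topology F)
    (T3 : forall A : set X, mdist_bounded A ->
      exists f : X -> R[i], exists delta : R,
        [/\ F f, 0 < delta &
            (delta%:E < ereal_inf [set (Normc.normc (f x))%:E | x in A])%E]) :
  weak_sharp_cvg_determining F (boundedly_finite_integrable F).
Proof.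
move=> mu_ mu Fmu_ Fmu cvgF g [cg [M [_ gM]]] /T3[f [delta [Ff delta0 fdelta]]].
(* The constant in [bounded_fun] only guarantees bounds strictly above it, hence [M + 1]. *)
have {gM} gM x : `|g x| <= M + 1 by apply: gM => //; rewrite ltrDl.
pose k := f \* (fun x => (f x)^*%C).
have Fk : F k by apply: T1_mul => //; exact: T1_conj.
have kE x : k x = (Normc.normc (f x) ^+ 2)%:C%C.
  rewrite /k/=; case: (f x) => a b /=.
  rewrite sqr_sqrtr ?addr_ge0 ?sqr_ge0//; simpc.
  by congr (_ +i* _)%C; ring.
have k0 x : 0 <= k x by rewrite kE lecR sqr_ge0.
pose h x := complex.Re (k x).
have hE x : h x = Normc.normc (f x) ^+ 2 by rewrite /h kE.
have ch : continuous h by move=> x; apply: cvg_Re; exact: (F_Cb k Fk).1.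
(* As [h] is the modulus of [k], its integrability is the integrability assumption on [F] taken at
   [k]. *)
have int_h nu : boundedly_finite_integrable F nu ->
    nu.-integrable setT (EFin \o (h : g_sigma_algebraType (@open X) -> R)).
  move=> [_ /(_ _ Fk) kfin]; apply/integrableP; split.
    by apply/measurable_EFinP; exact: continuous_measurable.
  apply: le_lt_trans kfin; rewrite le_eqVlt; apply/orP; left; apply/eqP.
  apply: eq_integral => x _ /=; congr (_%:E).
  by rewrite hE kE /= expr0n addr0 sqrtr_sqr.
have fA x : g x != 0 -> delta < Normc.normc (f x).
  move=> gx; rewrite -lte_fin (lt_le_trans fdelta)//.
  by apply: ereal_inf_lbound; exists x => //; exact: subset_closure.
have d20 : 0 < delta ^+ 2 by rewrite exprn_gt0.
(* [m] agrees with [h] on the support of [g] and is bounded away from [0]. *)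
pose m x := Num.max (h x) (delta ^+ 2).
have m_ge x : delta ^+ 2 <= m x by rewrite le_max lexx orbT.
have m0 x : 0 < m x by exact: lt_le_trans (m_ge x).
pose G x := g x / m x.
(* Where [g] vanishes both sides are 0; elsewhere [h x > delta ^+ 2], so the maximum defining [m x]
   is [h x]. *)
have GhE x : G x * h x = g x.
  rewrite /G; have [->|gx] := eqVneq (g x) 0; first by rewrite !mul0r.
  suff -> : h x = m x by rewrite divfK ?gt_eqF.
  by rewrite /m max_l// hE ler_sqr ?nnegrE ?ltW ?fA// (lt_trans delta0)// fA.
have cG : continuous G.
  move=> x; apply: cvgM; first exact: cg.
  apply: cvgV; first by rewrite gt_eqF.
  by apply: continuous_max; [exact: ch|exact: cvg_cst].
have bG : exists N : R, forall x, `|G x| <= N.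
  exists ((M + 1) / delta ^+ 2) => x; rewrite normrM ler_pM//.
  by rewrite gtr0_norm ?invr_gt0// lef_pV2 ?posrE.
have mG : @bounded_measurable _ (g_sigma_algebraType (@open X)) R G.
  exact: continuous_bounded_measurable.
(* The extended real integral of [g] is thus finite, and the convergence to be proved is one of real
   weighted integrals of [G]. *)
have gE nu : boundedly_finite_integrable F nu ->
    (\int[nu]_x (g x)%:E)%E =
      (@weighted_integral _ (g_sigma_algebraType (@open X)) R h nu G)%:E.
  move=> /int_h nuh; rewrite /weighted_integral fineK; last first.
    by apply: integrable_fin_num => //; exact: integrable_bounded_mul.
  by apply: eq_integral => x _ /=; rewrite GhE.
rewrite gE//; under eq_cvg do rewrite gE//.
apply: cvg_EFin; first exact: nearW.
exact: (bounded_continuous_weighted_cvg sepX F_Cb T1_mul T1_conj T2 Fk k0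
  (fun n => int_h _ (Fmu_ n)) (int_h _ Fmu) cvgF).
Qed.
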